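(* Let $S=K[x_1,\ldots,x_n]$, and let $I$ be a square-free monomial ideal of $S$ of degree $d$. Then $I$ is an $(n,d)^{th}$ unmixed $f$-ideal (that is, $I$ is an $f$-ideal and $I$ is unmixed) if and only if the following three conditions hold: (1) $|G(I)|=\frac{1}{2}\binom{n}{d}$; (2) $\dim \delta_{\mathcal F}(I)^{\vee}=n-d-1$; (3) $\langle \sigma(u) \mid u\in sm(S)_d\setminus G(I)\rangle$ is a $d$-flag complex.
   Context: $K$ is a field and $[n]=\{1,\ldots,n\}$. $sm(S)_d$ denotes the set of square-free monomials of degree $d$ in $S$. For a square-free monomial $u$, $\sigma(u)=\{i\in[n] \mid x_i\mid u\}$. $G(I)$ is the minimal monomial generating set of $I$; a square-free monomial ideal is of degree $d$ if it is nonzero and all elements of $G(I)$ have degree $d$. All simplicial complexes are regarded as complexes on $[n]$, so non-faces are subsets of $[n]$ that are not faces (elements of $[n]$ need not be vertices); $\langle F_1,\ldots,F_r\rangle$ denotes the simplicial complex of all subsets of the $F_i$. The facet complex of $I$ is $\delta_{\mathcal F}(I)=\langle \sigma(u)\mid u\in G(I)\rangle$; the Stanley–Reisner complex is $\delta_{\mathcal N}(I)=\{\sigma(g)\mid g \text{ a square-free monomial of } S,\ g\notin I\}$. $I$ is an $f$-ideal if $\delta_{\mathcal F}(I)$ and $\delta_{\mathcal N}(I)$ have the same $f$-vector (the same number of faces in each dimension). $I$ is unmixed if all its associated (equivalently, minimal) primes have the same height. The Alexander dual of a complex $\Delta$ on $[n]$ is $\Delta^{\vee}=\{[n]\setminus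 F \mid F\subseteq [n],\ F\notin\Delta\}$. The dimension of a complex is the maximal cardinality of a face minus $1$. A simplicial complex is a $d$-flag complex if all of its minimal non-faces contain exactly $d$ elements. *)

(* Defs.v *)
From HB Require Import structures.
From mathcomp Require Import all_boot all_order all_algebra.
From mathcomp Require Import boolp mpoly.

Set Implicit Arguments.
Unset Strict Implicit.
Unset Printing Implicit Defensive.

Import GRing.Theory.
Local Open Scope ring_scope.

(* [n] = {1, ..., n} is 'I_n and S = K[x_1, ..., x_n] is {mpoly K[n]}.        *)
(* Subsets of S are boolean predicates {pred S}: with the classical axioms    *)
(* of boolp, every Prop-valued subset is one of them.                         *)

Section SquareFreeMonomials.

Variable n : nat.

Definition squarefree (m : 'X_{1..n}) : bool := [forall i, (m i <= 1)%N].

Definition sigma (m : 'X_{1..n}) : {set 'I_n} := [set i | (U_(i) <= m)%MM].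

(* 'X_{1..n < n.+1} is the finite type of monomials of degree at most n; it   *)
(* contains all the square-free ones.                                         *)
Definition sm (d : nat) : {set 'X_{1..n < n.+1}} :=
  [set m : 'X_{1..n < n.+1} | squarefree m & mdeg m == d].

End SquareFreeMonomials.

Section SquareFreeMonomialIdeals.

Variables (K : fieldType) (n : nat).
Local Notation S := {mpoly K[n]}.
Local Notation mon := 'X_{1..n < n.+1}.
Implicit Types (I : {pred S}) (A : {set mon}).

Definition generates A I : Prop :=
  forall f : S, f \in I <-> exists c : mon -> S, f = \sum_(m in A) c m * 'X_[m].

Definition squarefree_monomial_ideal I : Prop :=
  exists2 A : {set mon}, (forall m, m \in A -> squarefree m) & generates A I.

(* The inclusion-minimal monomial generating set. When I is a square-free     *)
(* monomial ideal it exists, is unique and consists of square-free monomials, *)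
(* hence of elements of mon, and the default value set0 is not used.          *)
Definition mingens I : {set mon} :=
  odflt set0 [pick A : {set mon} |
               minset (fun B : {set mon} => `[< generates B I >]) A].

Definition squarefree_ideal_of_degree (d : nat) I : Prop :=
  [/\ squarefree_monomial_ideal I,
      exists2 f : S, f \in I & f != 0
    & forall m, m \in mingens I -> mdeg m = d].

End SquareFreeMonomialIdeals.

Section Unmixed.

Variable R : comNzRingType.
Implicit Types (I P : {pred R}) (h : nat).

(* idealr_closed includes properness. *)
Definition prime_ideal P : Prop := idealr_closed P /\ prime_idealr_closed P.

(* P is prime and is the annihilator of the class of some f in R / I. *)
Definition associated_prime I P : Prop :=
  prime_ideal P /\ exists f : R, forall g : R, (g \in P) = (g * f \in I).

(* c 0 < c 1 < ... < c h = P is a strict chain of primes; the values of c     *)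
(* beyond h are irrelevant.                                                   *)
Definition prime_chain_to P h : Prop :=
  exists c : nat -> {pred R},
    [/\ c h =i P,
        forall i, (i <= h)%N -> prime_ideal (c i)
      & forall i, (i < h)%N ->
          {subset c i <= c i.+1} /\ exists2 f, f \in c i.+1 & f \notin c i].

Definition has_height P h : Prop :=
  prime_chain_to P h /\ forall h', prime_chain_to P h' -> (h' <= h)%N.

Definition unmixed I : Prop :=
  exists h, forall P, associated_prime I P -> has_height P h.

End Unmixed.

Section Complexes.

Variable n : nat.
Implicit Types (D : {set {set 'I_n}}) (F : {set 'I_n}).

(* A complex is its set of faces, including the empty face if there is one. *)
Definition complex_span (A : {set {set 'I_n}}) : {set {set 'I_n}} :=
  [set F : {set 'I_n} | [exists E in A, F \subset E]].

Definition alexander_dual D : {set {set 'I_n}} := [set ~: F | F : {set 'I_n} in ~: D].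

(* The number of faces of dimension k - 1. *)
Definition nfaces D (k : nat) : nat := #|[set F : {set 'I_n} in D | #|F| == k]|.

Definition same_f_vector D D' : Prop := forall k, nfaces D k = nfaces D' k.

(* A relation, so that the complex without any face has no dimension. *)
Definition has_dim D (k : int) : Prop :=
  (exists2 F, F \in D & #|F|%:Z - 1 = k) /\
  (forall F, F \in D -> #|F|%:Z - 1 <= k).

Definition min_nonface D F : bool :=
  minset (fun E : {set 'I_n} => E \notin D) F.

Definition flag_complex (d : nat) D : Prop :=
  forall F, min_nonface D F -> #|F| = d.

End Complexes.

Section FIdeals.

Variables (K : fieldType) (n : nat).
Implicit Types I : {pred {mpoly K[n]}}.

Definition facet_complex I : {set {set 'I_n}} :=
  complex_span [set sigma u | u : 'X_{1..n < n.+1} in mingens I].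

Definition SR_complex I : {set {set 'I_n}} :=
  [set sigma g | g : 'X_{1..n < n.+1} in
     [pred g : 'X_{1..n < n.+1} | squarefree g & 'X_[g] \notin I]].

Definition f_ideal I : Prop := same_f_vector (facet_complex I) (SR_complex I).

End FIdeals.

(* Main.v *)
(* Write G for the d-subsets sigma(u), u in G(I), and U for the sets containing *)
(* no element of G, so that U is the Stanley-Reisner complex of I. Comparing    *)
(* face numbers size by size, I is an f-ideal iff 2|G| = C(n, d), every set     *)
(* with fewer than d elements lies in an element of G, and no set with more     *)
(* than d elements is in U. The associated primes of I are the ideals           *)
(* (x_i | i notin F) for F a facet of U, and such a prime has height n - |F|;   *)
(* hence, for an f-ideal, I is unmixed iff every set with fewer than d elements *)
(* lies in a d-set outside G. Conditions (1)-(3) say the same thing.            *)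
(* The height bound comes from counting, in place of Krull's theorem: if S / Q  *)
(* contains, for each N, N^t linearly independent classes of polynomials of     *)
(* degree O(N), and P is a prime strictly below Q, then S / P contains N^(t+1)  *)
(* of them, whereas S itself has only O(N^n).                                   *)

Require Import Defs.
From mathcomp Require Import all_boot all_order all_algebra.
From mathcomp Require Import mpoly.
From mathcomp Require Import boolp zify.

Set Implicit Arguments.
Unset Strict Implicit.
Unset Printing Implicit Defensive.

Import GRing.Theory.
Local Open Scope ring_scope.

(** Everything reduces to four statements about $G$: (a) $2|G| = C(n,d)$; (b) every set with fewer
    than $d$ elements lies in a member of $G$; (c) every such set lies in a $d$-set outside $G$; (d)
    every set with more than $d$ elements contains a member of $G$. Being an f-ideal amounts to (a),
    (b) and (d) ([same_f_vectorP]), and, given (a) and (d), unmixedness amounts to (c) ([unmixedP]).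
    On the other side, condition (1) is (a); condition (2) is (b) together with the existence of a
    $d$-set outside $G$ ([has_dim_dualP]), which (a) provides because $I$ is nonzero ([ex_non_gen]);
    condition (3) is (c) and (d) ([flag_complexP]). The algebra behind [unmixedP] is the description
    of the associated primes ([facet_associated], [associated_facet]) and of their heights
    ([coord_prime_height]). *)

Section UniformFamilies.

(** * Combinatorics of a family of $d$-subsets of $[n]$ *)

Variables (n d : nat) (G : {set {set 'I_n}}).
Implicit Types E F : {set 'I_n}.

(** The complex $U$: the Stanley-Reisner complex of the ideal whose generators have the members of
    [G] as supports. *)
Definition free_sets : {set {set 'I_n}} :=
  [set F : {set 'I_n} | [forall E in G, ~~ (E \subset F)]].

Lemma free_setsPn F : reflect (exists2 E, E \in G & E \subset F) (F \notin free_sets).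
Proof.
rewrite inE negb_forall_in; apply: (iffP exists_inP) => -[E EG].
  by rewrite negbK; exists E.
by exists E; rewrite ?negbK.
Qed.

Lemma free_sets_sub F F' : F' \subset F -> F \in free_sets -> F' \in free_sets.
Proof.
move=> sF'F; apply: contraTT => /free_setsPn[E EG sEF']; apply/free_setsPn.
by exists E => //; apply: subset_trans sF'F.
Qed.

Lemma complex_spanP (A : {set {set 'I_n}}) F :
  reflect (exists2 E, E \in A & F \subset E) (F \in complex_span A).
Proof. by rewrite inE; apply: (iffP exists_inP). Qed.

Hypothesis G_d : {in G, forall E, #|E| = d}.

Definition non_gens : {set {set 'I_n}} := [set F : {set 'I_n} | #|F| == d] :\: G.

Lemma non_gensP F : reflect (#|F| = d /\ F \notin G) (F \in non_gens).
Proof. by rewrite !inE andbC; apply: (iffP andP) => -[/eqP]. Qed.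

Lemma card_span_le F : F \in complex_span G -> (#|F| <= d)%N.
Proof. by case/complex_spanP => E EG sFE; rewrite -(G_d EG) subset_leq_card. Qed.

Lemma mem_span_card F : #|F| = d -> (F \in complex_span G) = (F \in G).
Proof.
move=> cF; apply/complex_spanP/idP => [[E EG sFE]|FG]; last by exists F.
by have /eqP-> : F == E by rewrite eqEcard sFE cF G_d /=.
Qed.

Lemma free_sets_small F : (#|F| < d)%N -> F \in free_sets.
Proof.
apply: contraTT => /free_setsPn[E EG /subset_leq_card].
by rewrite (G_d EG) -leqNgt.
Qed.

Lemma mem_free_card F : #|F| = d -> (F \in free_sets) = (F \notin G).
Proof.
move=> cF; apply/idP/idP; last first.
  apply: contraNT => /free_setsPn[E EG sEF].
  by have /eqP<- : E == F by rewrite eqEcard sEF cF G_d /=.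
by apply: contraTN => FG; apply/free_setsPn; exists F.
Qed.

Lemma card_gens_le : (#|G| <= 'C(n, d))%N.
Proof.
rewrite -[n in 'C(n, _)]card_ord -card_draws; apply/subset_leq_card/subsetP => E EG.
by rewrite inE G_d.
Qed.

Lemma nfaces_span : nfaces (complex_span G) d = #|G|.
Proof.
apply: eq_card => F; rewrite inE; apply/andP/idP => [[FL /eqP cF]|FG].
  by rewrite -mem_span_card.
by rewrite mem_span_card G_d.
Qed.

Lemma nfaces_free : nfaces free_sets d = ('C(n, d) - #|G|)%N.
Proof.
rewrite -[n in 'C(n, _)]card_ord -card_draws.
have sG : G \subset [set F : {set 'I_n} | #|F| == d].
  by apply/subsetP => E EG; rewrite inE G_d.
rewrite -(setIidPr sG) -cardsD; apply: eq_card => F; rewrite in_set in_setD [in RHS]in_set.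
by case: eqP => [cF|_]; rewrite ?andbF // !andbT mem_free_card.
Qed.

(** Below size $d$ every set is free, so equal face numbers force every set into the span. Above
    size $d$ the span has no face, so there can be no free set. In size $d$ the two complexes split
    the $d$-sets into [G] and its complement. *)
Lemma same_f_vectorP :
  same_f_vector (complex_span G) free_sets <->
  [/\ #|G|.*2 = 'C(n, d),
      forall F, (#|F| < d)%N -> F \in complex_span G
    & forall F, (d < #|F|)%N -> F \notin free_sets].
Proof.
have leG := card_gens_le.
split=> [same | [cG small big] k].
  split=> [|F ltFd|F ltdF].
  - by have := same d; rewrite nfaces_span nfaces_free; lia.
  - have sub : [set F' in complex_span G | #|F'| == #|F|] \subset
               [set F' in free_sets | #|F'| == #|F|].
      apply/subsetP => F'; rewrite !(inE, in_setI) => /andP[_ /eqP cF'].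
      have := @free_sets_small F'; rewrite cF' inE => -> //; exact/eqP.
    have /eqP eqs : [set F' in complex_span G | #|F'| == #|F|] ==
               [set F' in free_sets | #|F'| == #|F|].
      by rewrite eqEcard sub /=; have := same #|F|; rewrite /nfaces => ->.
    have : F \in [set F' in free_sets | #|F'| == #|F|].
      by rewrite in_set free_sets_small // eqxx.
    by rewrite -eqs in_set => /andP[].
  - apply/negP => FU; have := same #|F|; rewrite /nfaces.
    rewrite [X in X = _]eq_card0; last first.
      move=> F'; rewrite in_set; apply/andP => -[/card_span_le le /eqP eqF].
      by rewrite eqF leqNgt ltdF in le.
    by move/esym/eqP; apply/negP; rewrite -lt0n (cardD1 F) in_set FU eqxx.
have [ltk|ltk|->] := ltngtP k d.
- apply: eq_card => F; rewrite [LHS]in_set [RHS]in_set;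
  case: eqP; rewrite ?andbF ?andbT // => cF.
  by rewrite small ?free_sets_small ?cF.
- rewrite /nfaces !eq_card0 // => F; rewrite in_set;
  case: eqP; rewrite ?andbF ?andbT // => cF.
    by apply/negbTE/big; rewrite cF.
  by apply/negP => /card_span_le; rewrite cF leqNgt ltk.
- by rewrite nfaces_span nfaces_free; lia.
Qed.

(** A face of the dual of dimension $k$ is the complement of a non-face with $n-k-1$ elements, so
    the largest dual faces correspond to the smallest non-faces. *)
Lemma has_dim_dualP :
  has_dim (alexander_dual (complex_span G)) (n%:Z - d%:Z - 1) <->
  (exists2 F : {set 'I_n}, #|F| = d & F \notin complex_span G) /\
  (forall F, (#|F| < d)%N -> F \in complex_span G).
Proof.
have cC F : (#|F| + #|~: F| = n)%N by rewrite cardsC card_ord.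
split=> [[[F' /imsetP[F FL ->]] cF le]|[[F cF FL] small]].
  split; first by exists F; [have := cC F; lia | rewrite inE in FL].
  move=> F1 lt1; apply/contraT => F1L.
  have := le (~: F1); have := cC F1; rewrite imset_f ?inE //; last by rewrite inE in F1L.
  by move=> cF1 /(_ isT); lia.
split.
  by exists (~: F); [rewrite imset_f // inE | have := cC F; lia].
move=> F' /imsetP[F1 F1L ->]; rewrite inE in F1L.
have : (d <= #|F1|)%N by rewrite leqNgt; apply: contra F1L => /small.
by have := cC F1; lia.
Qed.

(** A set with more than $d$ elements is a non-face, hence contains a minimal one; if that one has
    $d$ elements, it belongs to [G]. Conversely members of [G] are non-faces, so a minimal non-face
    containing one is equal to it. *)
Lemma flag_complexP :
  flag_complex d (complex_span non_gens) <->
  (forall F, (#|F| < d)%N -> F \in complex_span non_gens) /\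
  (forall F, (d < #|F|)%N -> F \notin free_sets).
Proof.
have ND F : F \in G -> F \notin complex_span non_gens.
  move=> FG; apply/complex_spanP => -[E /non_gensP[cE]] /negP EG sFE; apply: EG.
  by have /eqP<- : F == E by rewrite eqEcard sFE cE (G_d FG) /=.
split=> [flag | [small big] F /minsetP[FD minF]].
  split=> F ltF.
    apply/contraT => FD; have [A minA sAF] := minset_exists (P := fun E => E \notin _) FD.
    by have := subset_leq_card sAF; rewrite (flag A minA) leqNgt ltF.
  have FD : F \notin complex_span non_gens.
    apply/complex_spanP => -[E /non_gensP[cE _] /subset_leq_card].
    by rewrite cE leqNgt ltF.
  have [A minA sAF] := minset_exists (P := fun E => E \notin _) FD.
  apply/free_setsPn; exists A => //; have cA := flag A minA.
  apply: contraT => AG; case/minsetP: minA => /complex_spanP[].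
  by exists A => //; apply/non_gensP.
have [lt|lt|//] := ltngtP #|F| d; first by rewrite small in FD.
have /free_setsPn[E EG sEF] := big F lt.
by rewrite -(minF E (ND E EG) sEF) G_d.
Qed.

(** Under these hypotheses the Stanley-Reisner complex is pure, with the $d$-sets outside [G] as its
    facets. *)
Lemma free_sets_span :
  (forall F, (#|F| < d)%N -> F \in complex_span non_gens) ->
  (forall F, (d < #|F|)%N -> F \notin free_sets) ->
  free_sets = complex_span non_gens.
Proof.
move=> small big; apply/setP => F; apply/idP/complex_spanP => [FU|[E /non_gensP[cE EG] sFE]].
  have [lt|lt|cF] := ltngtP #|F| d.
  - exact/complex_spanP/small.
  - by rewrite (negbTE (big F lt)) in FU.
  - by exists F => //; apply/non_gensP; rewrite -mem_free_card.
by apply: free_sets_sub sFE _; rewrite mem_free_card.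
Qed.

End UniformFamilies.

(** * Ideals and primes given as predicates *)

Section RingIdeals.

Variables (R : comNzRingType) (P : {pred R}).

Section Closed.
Hypothesis idP : idealr_closed P.

Lemma ideal1 : 1 \notin P. Proof. by case: idP. Qed.

Lemma idealD x y : x \in P -> y \in P -> x + y \in P.
Proof. by case: idP => _ _ H xP yP; rewrite -[x]mul1r; apply: H. Qed.

Lemma idealMl a x : x \in P -> a * x \in P.
Proof. by case: idP => P0 _ H xP; rewrite -[_ * _]addr0; apply: H. Qed.

Lemma idealDl x y : y \in P -> x + y \in P -> x \in P.
Proof. by move=> yP xyP; rewrite -[x](addrK y) -[- y]mulN1r idealD ?idealMl. Qed.

End Closed.

Lemma prime_prodPn (T : finType) (A : {pred T}) (F : T -> R) :
  prime_ideal P -> {in A, forall i, F i \notin P} -> \prod_(i in A) F i \notin P.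
Proof.
case=> idP prP FP; elim/big_rec: _ => [|i x iA xP]; first exact: ideal1.
by apply/negP => /prP; rewrite (negbTE (FP i iA)) (negbTE xP).
Qed.

End RingIdeals.

(** * Counting independent classes of bounded degree modulo an ideal *)

Section Growth.

Variables (K : fieldType) (n : nat).
Local Notation S := {mpoly K[n]}.
Implicit Types (P Q : {pred S}) (f : S).

(** For an ideal [P], this is $K$-linear independence of the classes of the [v j] in $S/P$. *)
Definition free_mod (J : finType) P (v : J -> S) : Prop :=
  forall a : J -> K, \sum_j a j *: v j \in P -> forall j, a j = 0.

(* Plays the role of [t <= trdeg_K (S / P)]. *)
Definition growth P (t : nat) : Prop :=
  exists D, forall N, exists (J : finType) (v : J -> S),
    [/\ #|J| = (N ^ t)%N, forall j, (msize (v j) <= (D * N).+1)%N & free_mod P v].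

Lemma msizeM_leD f g : (msize (f * g) <= (msize f + msize g).-1)%N.
Proof.
have [->|f0] := eqVneq f 0; first by rewrite mul0r msize0.
have [->|g0] := eqVneq g 0; first by rewrite mulr0 msize0.
by rewrite msizeM.
Qed.

Lemma msize_exp_le f k : (msize (f ^+ k) <= (msize f * k).+1)%N.
Proof.
elim: k => [|k IH]; first by rewrite expr0 msize1.
by rewrite exprS; have := msizeM_leD f (f ^+ k); nia.
Qed.

(** The class of $1$ alone is independent, since [P] is proper. *)
Lemma growth0 P : idealr_closed P -> growth P 0.
Proof.
move=> idP; exists 0%N => N; exists unit, (fun=> 1); rewrite card_unit; split=> //.
  by move=> _; rewrite msize1.
move=> a; rewrite (bigD1 tt) //= big1 ?addr0 => [aP []|[]] //.
apply/eqP/contraT => a0; have := ideal1 idP.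
suff -> : 1 = (a tt)^-1%:MP * (a tt *: 1) :> S by rewrite (idealMl idP).
by rewrite mul_mpolyC scalerA mulVf // scale1r.
Qed.

(* Mod Q the terms with k > 0 vanish, so the coefficients for k = 0 are zero; *)
(* dividing by f, which is legitimate mod P, one proceeds to the next k.      *)
Lemma free_mod_powers P Q f (J : finType) (v : J -> S) N :
  prime_ideal P -> idealr_closed Q -> {subset P <= Q} -> f \in Q -> f \notin P ->
  free_mod Q v -> free_mod P (fun kj : 'I_N * J => f ^+ kj.1 * v kj.2).
Proof.
move=> [idP prP] idQ sPQ fQ fP free a aP.
(* The first index of the coefficients ranges over all of [nat], so that the induction on [N] can
   shift it by one; [inord] converts back from ordinals. *)
suff main (b : nat -> J -> K) :
    \sum_(k < N) f ^+ k * \sum_j b k j *: v j \in P -> forall k j, (k < N)%N -> b k j = 0.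
  case=> k j; case: N a aP k main => [|N] a aP k main; first by case: k.
  have := main (fun k j => a (inord k, j)) _ k j (ltn_ord k).
  rewrite inord_val; apply; rewrite [X in X \in P](_ : _ = \sum_p a p *: (f ^+ p.1 * v p.2)) //.
  transitivity (\sum_i \sum_j a (i, j) *: (f ^+ i * v j)).
    apply: eq_bigr => i _; rewrite mulr_sumr; apply: eq_bigr => j' _.
    by rewrite inord_val scalerAr.
  by rewrite pair_bigA /=; apply: eq_bigr => -[].
elim: N b {a aP} => [|N IH] b; first by [].
pose w := \sum_(k < N) f ^+ k * \sum_j b k.+1 j *: v j.
rewrite big_ord_recl expr0 mul1r [X in _ + X](_ : _ = f * w) => [bP|]; last first.
  by rewrite mulr_sumr; apply: eq_bigr => k _; rewrite lift0 exprS mulrA.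
have b0 : forall j, b 0%N j = 0.
  apply: free; apply: (idealDl idQ (y := f * w)); first by rewrite mulrC idealMl.
  exact: sPQ.
have wP : w \in P.
  move: bP; rewrite big1 ?add0r => [/prP|j _]; first by rewrite (negbTE fP).
  by rewrite b0 scale0r.
by case=> [|k] j // ltk; apply: (IH (fun k => b k.+1)).
Qed.

Lemma growth_step P Q f t :
  prime_ideal P -> idealr_closed Q -> {subset P <= Q} -> f \in Q -> f \notin P ->
  growth Q t -> growth P t.+1.
Proof.
(* A product of some [f ^+ k], [k < N], with some [v j] still has degree linear in [N]; the slope
   grows by at most [msize f]. *)
move=> prP idQ sPQ fQ fP [D gr]; exists (D + msize f)%N => N.
have [J [v [cJ szv freev]]] := gr N.
exists ('I_N * J)%type, (fun kj : 'I_N * J => f ^+ kj.1 * v kj.2); split.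
- by rewrite card_prod card_ord cJ expnS.
- case=> k j /=; have := msizeM_leD (f ^+ k) (v j); have := msize_exp_le f k.
  by have := szv j; have := ltn_ord k; nia.
- exact: free_mod_powers freev.
Qed.

(** The chain is descended from its top, each strict inclusion adding one to the exponent. *)
Lemma growth_chain (c : nat -> {pred S}) h t :
  (forall i, (i <= h)%N -> prime_ideal (c i)) ->
  (forall i, (i < h)%N ->
     {subset c i <= c i.+1} /\ exists2 f, f \in c i.+1 & f \notin c i) ->
  growth (c h) t -> growth (c 0%N) (t + h).
Proof.
elim: h t => [|h IH] t prc ltc gr; first by rewrite addn0.
have [sub [f fc fNc]] := ltc h (leqnn _).
rewrite addnS -addSn; apply: IH => [i lei|i lti|].
- by apply: prc; lia.
- by apply: ltc; lia.
- by apply: (growth_step _ _ sub fc fNc gr); [apply: prc | case: (prc h.+1 (leqnn _))].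
Qed.

(** Since [P] contains $0$, the [v j] are independent in $S$ itself. Their monomials lie in the box
    of exponents at most [B], which has $(B+1)^n$ points, so the matrix of coefficients [M], with
    that many columns, has independent rows. *)
Lemma free_mod_card P (J : finType) (v : J -> S) B :
  0 \in P -> (forall j, (msize (v j) <= B.+1)%N) -> free_mod P v ->
  (#|J| <= B.+1 ^ n)%N.
Proof.
move=> P0 szv free.
pose T := {ffun 'I_n -> 'I_B.+1}.
pose mon (g : T) : 'X_{1..n} := [multinom (g i : nat) | i < n].
pose M : 'M[K]_(#|J|, #|T|) := \matrix_(j, g) (v (enum_val j))@_(mon (enum_val g)).
rewrite -[B.+1]card_ord -[n]card_ord -card_ffun -/T.
suff /eqP<- : row_free M by exact: rank_leq_col.
rewrite -kermx_eq0; apply/rowV0P => u /sub_kermxP uM0.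
pose w := \sum_j u 0 (enum_rank j) *: v j.
suff w0 : w = 0.
  apply/rowP => i; rewrite mxE -[i]enum_valK.
  by apply: (free (fun j => u 0 (enum_rank j))); rewrite -/w w0.
apply/mpolyP => m; rewrite mcoeff0.
have [leB|ltB] := leqP (mdeg m) B; last first.
  apply/eqP; rewrite mcoeff_eq0; apply: msize_mdeg_ge; apply: leq_trans ltB.
  rewrite /w; elim/big_ind: _ => [|x y lex ley|j _]; first by rewrite msize0.
    by apply: leq_trans (mmeasureD_le _ _ _) _; rewrite geq_max lex.
  by apply: leq_trans (msizeZ_le _ _) (szv j).
have lemB i : (m i < B.+1)%N by rewrite ltnS (leq_trans _ leB) // mdegE (bigD1 i) ?leq_addr.
pose g : T := [ffun i => Ordinal (lemB i)].
have mg : mon g = m by apply/mnmP => i; rewrite mnmE ffunE.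
have := congr1 (fun A : 'rV_#|T| => A 0 (enum_rank g)) uM0.
rewrite !mxE => <-; rewrite /w raddf_sum /=.
rewrite (reindex (fun i : 'I_#|J| => enum_val i)) /=; last first.
  by apply: onW_bij; apply: enum_val_bij.
by apply: eq_bigr => j _; rewrite mxE mcoeffZ enum_valK enum_rankK mg.
Qed.

Lemma growth_le P t : 0 \in P -> growth P t -> (t <= n)%N.
Proof.
move=> P0 [D gr]; rewrite leqNgt; apply/negP => ltnt.
(* This [N] exceeds $(D+1)^n$, so that $(DN+1)^n \le (D+1)^n N^n < N^{n+1} \le N^t$. *)
pose N := (D.+1 ^ n).+1; have [J [v [cJ szv free]]] := gr N.
have := free_mod_card P0 szv free; rewrite cJ leqNgt => /negP; apply.
have le1 : ((D * N).+1 ^ n <= (D.+1 * N) ^ n)%N.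
  by have [->//|n0] := posnP n; rewrite leq_exp2r // mulSn addnC -addn1 leq_add2l.
apply: leq_ltn_trans le1 _; rewrite expnMn.
apply: (@leq_trans (N ^ n.+1)); last by rewrite leq_pexp2l.
by rewrite expnS ltn_mul2r expn_gt0 /= ltnS.
Qed.

End Growth.

(** * Primes generated by variables, and their heights *)

Section CoordinatePrimes.

Variables (K : fieldType) (n : nat).
Local Notation S := {mpoly K[n]}.
Implicit Types (C F : {set 'I_n}) (m : 'X_{1..n}) (f : S).

Lemma in_sigma m i : (i \in sigma m) = (m i != 0%N).
Proof. by rewrite inE lep1mP. Qed.

Lemma sigmaD m m' : sigma (m + m')%MM = sigma m :|: sigma m'.
Proof. by apply/setP => i; rewrite in_setU !in_sigma mnmDE addn_eq0 negb_and. Qed.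

(** Substituting this tuple projects $S$ onto the polynomials in the variables outside [C]; the
    prime below is the kernel of this ring morphism, hence prime because $S$ is a domain. *)
Definition vanish C : n.-tuple S := [tuple if i \in C then 0 else 'X_i | i < n].

(* The ideal (x_i | i in C). *)
Definition coord_prime C : {pred S} := [pred f | f \mPo vanish C == 0].

Lemma mcoeff_vanish C f m :
  (f \mPo vanish C)@_m = if [disjoint C & sigma m] then f@_m else 0.
Proof.
have vX m' : 'X_[m'] \mPo vanish C = if [disjoint C & sigma m'] then 'X_[m'] else 0 :> S.
  rewrite comp_mpolyX; case: ifPn => [dis|].
    rewrite mpolyXE_id; apply: eq_bigr => i _; rewrite tnth_mktuple.
    case: ifP => // iC; have := disjointFr dis iC; rewrite in_sigma => /negbFE/eqP->.
    by rewrite !expr0.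
  rewrite -setI_eq0 => /set0Pn[i]; rewrite inE in_sigma => /andP[iC mi].
  by rewrite (bigD1 i) //= tnth_mktuple iC expr0n (negbTE mi) mul0r.
have -> : f@_m = \sum_(m' <- msupp f) (f@_m' *: 'X_[m'])@_m.
  by rewrite {1}[f]mpolyE raddf_sum.
rewrite comp_mpolyEX raddf_sum /=.
have E m' : (f@_m' *: ('X_[m'] \mPo vanish C))@_m =
            if [disjoint C & sigma m] then (f@_m' *: 'X_[m'])@_m else 0.
  rewrite vX !mcoeffZ (mcoeffX _ m' m); have [->|ne] := eqVneq m' m.
    by case: ifP; rewrite ?mcoeffX ?eqxx ?mcoeff0 ?mulr0.
  by rewrite mulr0 if_same; case: ifP; rewrite ?mcoeffX ?(negbTE ne) ?mcoeff0 mulr0.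
by under eq_bigr do rewrite E; case: ifP => // _; rewrite big1.
Qed.

(** Phrased with [~: C] because [C] will be the complement of a facet $F$: no monomial of [f] may be
    supported in $F$. *)
Lemma coord_primeP C f :
  reflect (forall m, m \in msupp f -> ~~ (sigma m \subset ~: C)) (f \in coord_prime C).
Proof.
apply: (iffP eqP) => [f0 m|H].
  rewrite mcoeff_msupp; apply: contra => sm.
  have := mcoeff_vanish C f m; rewrite f0 mcoeff0 disjoint_sym disjoints_subset sm.
  by move=> <-.
apply/mpolyP => m; rewrite mcoeff_vanish mcoeff0 disjoint_sym disjoints_subset.
case: ifP => // sm; apply/eqP; rewrite mcoeff_eq0; apply/negP => /H.
by rewrite sm.
Qed.

Lemma coord_prime_prime C : prime_ideal (coord_prime C).
Proof.
split; first split.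
- by rewrite inE comp_mpoly0.
- by rewrite inE comp_mpoly1 oner_eq0.
- move=> a x y; rewrite !inE => /eqP x0 /eqP y0.
  by rewrite comp_mpolyD rmorphM /= x0 y0 mulr0 addr0.
- by move=> x y; rewrite !inE rmorphM mulf_eq0.
Qed.

Lemma coord_prime_sub C C' : C \subset C' -> {subset coord_prime C <= coord_prime C'}.
Proof.
move=> sCC' f /coord_primeP fC; apply/coord_primeP => m /fC; apply: contra.
by move/subset_trans; apply; rewrite setCS.
Qed.

Lemma coord_primeX C i : ('X_i \in coord_prime C) = (i \in C).
Proof.
rewrite inE comp_mpolyXU -tnth_nth tnth_mktuple; case: ifP; rewrite ?eqxx //.
by rewrite -msupp_eq0 msuppX.
Qed.

(** The variables indexed by [C' :\: C] are adjoined one at a time. From the empty set to [C], such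
    a chain bounds the height from below; from [C] to $[n]$, it yields [coord_prime_growth]. *)
Lemma coord_prime_chain C C' : C \subset C' ->
  exists c : nat -> {pred S},
    [/\ c 0%N = coord_prime C, c #|C' :\: C| = coord_prime C',
        forall i, prime_ideal (c i)
      & forall i, (i < #|C' :\: C|)%N ->
          {subset c i <= c i.+1} /\ exists2 f, f \in c i.+1 & f \notin c i].
Proof.
move=> sCC'; set s := enum (C' :\: C).
exists (fun k => coord_prime (C :|: [set i in take k s])); split.
- congr coord_prime; apply/setP => i; rewrite take0 !inE orbF //.
- congr coord_prime; rewrite cardE take_size; apply/setP => i.
  rewrite !inE mem_enum !inE; case: (boolP (i \in C)) => //= iC.
  by rewrite (subsetP sCC').
- by move=> i; apply: coord_prime_prime.
move=> k ltk; have ltks : (k < size s)%N by rewrite -cardE.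
have [x0 _] : exists x0, x0 \in s by case: (s) ltks => // x0 ? _; exists x0; rewrite mem_head.
split.
  apply/coord_prime_sub/setUS/subsetP => i; rewrite !inE (take_nth x0) // mem_rcons inE => ->.
  by rewrite orbT.
exists 'X_(nth x0 s k); rewrite coord_primeX !inE.
  by rewrite (take_nth x0) // mem_rcons mem_head orbT.
have /[!mem_enum]/[!inE]/andP[xC _] := mem_nth x0 ltks.
rewrite negb_or xC /=; have := enum_uniq (C' :\: C); rewrite -/s -{1}(cat_take_drop k s).
rewrite cat_uniq => /and3P[_ /hasPn H _]; apply: H.
by rewrite (drop_nth x0) // mem_head.
Qed.

Lemma coord_prime_growth C : growth (coord_prime C) #|~: C|.
Proof.
have [c [c0 cT prc ltc]] := coord_prime_chain (subsetT C).
rewrite -setTD -c0 -[#|_|]add0n; apply: growth_chain => //.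
by apply: growth0; case: (prc #|setT :\: C|).
Qed.

(* Along a strict chain of primes the transcendence degree of the residue ring *)
(* drops at each step, from at most n to #|~: C|.                             *)
Lemma coord_prime_height C : has_height (coord_prime C) #|C|.
Proof.
split.
  have [c [_ cC prc ltc]] := coord_prime_chain (sub0set C).
  exists c; rewrite setD0 in cC ltc; split=> //; by rewrite cC.
move=> h [c [ch prc ltc]].
have := coord_prime_growth C; rewrite (_ : coord_prime C = c h); last first.
  by apply/funext => f; have := ch f; rewrite !unfold_in.
move=> /(growth_chain prc ltc) /growth_le.
have [[c0 _ _] _] := prc 0%N isT; move=> /(_ c0).
by have := cardsC C; rewrite card_ord; lia.
Qed.

End CoordinatePrimes.

(** * Square-free monomial ideals: membership and associated primes *)

Section StanleyReisner.

Variables (K : fieldType) (n : nat).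
Local Notation S := {mpoly K[n]}.
Implicit Types (I P : {pred S}) (f g : S) (m : 'X_{1..n}) (C F : {set 'I_n}).

Lemma sigma_mesym1 F : sigma (mesym1 F) = F.
Proof. by apply/setP => i; rewrite in_sigma mnmE; case: (i \in F). Qed.

Lemma squarefree_mesym1 F : squarefree (mesym1 F).
Proof. by apply/forallP => i; rewrite mnmE leq_b1. Qed.

Lemma squarefreeE m : squarefree m -> m = mesym1 (sigma m).
Proof.
move/forallP => sqm; apply/mnmP => i; rewrite mnmE in_sigma.
by case: (m i) (sqm i) => [|[|]].
Qed.

Lemma squarefree_sigma_inj : {in @squarefree n &, injective (@sigma n)}.
Proof. by move=> m m' /squarefreeE m_sq /squarefreeE m'_sq eqs; rewrite m_sq m'_sq eqs. Qed.

Lemma mdeg_squarefree m : squarefree m -> mdeg m = #|sigma m|.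
Proof. by move/squarefreeE => {1}->; rewrite mdeg_mesym1. Qed.

Lemma squarefree_le m m' : squarefree m -> (m <= m')%MM = (sigma m \subset sigma m').
Proof.
move=> /forallP sqm; apply/mnm_lepP/subsetP => [le i|sub i].
  by rewrite !in_sigma -!lt0n => /leq_trans; apply.
have := sub i; rewrite !in_sigma; have := sqm i.
by case: (m i) => [|[|]] //= _; rewrite lt0n; apply.
Qed.

Lemma mdeg_le_eq m m' : (m <= m')%MM -> mdeg m = mdeg m' -> m = m'.
Proof.
move=> le eqd; have : mdeg (m' - m)%MM = 0%N.
  by have := congr1 mdeg (submK le); rewrite mdegD; lia.
by move/eqP; rewrite mdeg_eq0 -{2}(submK le) => /eqP->; rewrite add0m.
Qed.

Lemma generates_mem (A : {set 'X_{1..n < n.+1}}) I f : generates A I ->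
  f \in I <-> forall m, m \in msupp f -> exists2 a, a \in A & (a <= m)%MM.
Proof.
move=> gen; split=> [/gen[c ->] m|H].
  rewrite mcoeff_msupp raddf_sum /= => nz.
  have [a /andP[aA nza]] : exists a, (a \in A) && ((c a * 'X_[a])@_m != 0).
    apply/existsP; apply: contraR nz => /existsPn na; apply/eqP/big1 => a aA.
    by apply/eqP; have := na a; rewrite aA /= negbK.
  exists a => //; move: nza; rewrite -mcoeff_msupp (perm_mem (msuppMX _ _)).
  by case/mapP => m' _ ->; apply: lem_addr.
apply/gen.
(* [h] picks a generator dividing each monomial of [f], with the monomial $1$ as default elsewhere;
   the terms of [f] are then grouped by their value under [h]. *)
have [h hP] : {h : 'X_{1..n} -> 'X_{1..n < n.+1} &
    forall m, m \in msupp f -> h m \in A /\ (h m <= m)%MM}.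
  apply: (choice (P := fun m a => m \in msupp f -> a \in A /\ (a <= m)%MM)) => m.
  have [/H[a aA am]|_] := boolP (m \in msupp f); first by exists a.
  have lt0 : (mdeg (0%MM : 'X_{1..n}) < n.+1)%N by rewrite mdeg0.
  by exists (BMultinom lt0).
exists (fun a => \sum_(m <- msupp f | h m == a) f@_m *: 'X_[m - a]).
rewrite [LHS]mpolyE.
transitivity (\sum_(a in A) \sum_(m <- msupp f | h m == a) f@_m *: 'X_[m]).
  rewrite (exchange_big_dep xpredT) //=; apply: eq_big_seq => m /hP[hA _].
  by rewrite (big_pred1 (h m)) // => a; apply/andP/eqP => [[_ /eqP->]|->].
apply: eq_bigr => a _; rewrite mulr_suml big_seq_cond [RHS]big_seq_cond.
by apply: eq_bigr => m /andP[/hP[_ le] /eqP<-]; rewrite -scalerAl -mpolyXD submK.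
Qed.

Section Complex.

Variables (I : {pred S}) (U : {set {set 'I_n}}).
(** Together with [mem_I], this says that [U] is a complex and [I] its Stanley-Reisner ideal. *)
Hypothesis U_sub : forall F F', F' \subset F -> F \in U -> F' \in U.
Hypothesis mem_I : forall f, f \in I <-> {in msupp f, forall m, sigma m \notin U}.

Definition facet F := maxset (fun E : {set 'I_n} => E \in U) F.

(** Every face lies in a facet, so a monomial supported on a face is missed by the prime of some
    facet: [I] is the intersection of these primes. *)
Lemma mem_SR_coord f :
  f \in I <-> forall F, facet F -> f \in coord_prime (~: F).
Proof.
split=> [/mem_I fI F /maxsetp FU|H].
  apply/coord_primeP => m /fI; rewrite setCK; apply: contra => sub.
  exact: U_sub FU.
apply/mem_I => m mf; apply/negP => mU.
have [F facF sF] := maxset_exists (P := fun E => E \in U) mU.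
by move: (H F facF) => /coord_primeP/(_ m mf); rewrite setCK sF.
Qed.

(** The prime is the annihilator of the class of $x_F$: by maximality of $F$, the support of $m x_F$
    is a face exactly when that of $m$ lies in $F$. *)
Lemma facet_associated F : facet F -> associated_prime I (coord_prime (~: F)).
Proof.
move=> /maxsetP[FU maxF]; split; first exact: coord_prime_prime.
exists 'X_[mesym1 F] => g; apply/idP/idP => [/coord_primeP gF|/mem_I gI].
  apply/mem_I => m; rewrite (perm_mem (msuppMX _ _)) => /mapP[m' /gF + ->].
  rewrite setCK sigmaD sigma_mesym1; apply: contra => m'U.
  by rewrite -(maxF _ m'U (subsetUl _ _)) subsetUr.
apply/coord_primeP => m mg; rewrite setCK; apply/negP => sub.
have /gI : (mesym1 F + m)%MM \in msupp (g * 'X_[mesym1 F]).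
  by rewrite (perm_mem (msuppMX _ _)) map_f.
by rewrite sigmaD sigma_mesym1 (setUidPl sub) FU.
Qed.

(** Let $P = (I : f)$. It lies in the prime of every facet in [A], those whose prime misses [f]. If
    none of these primes were inside $P$, choose in each an element outside $P$. Their product is
    not in the prime $P$, yet its multiple by [f] lies in the primes of all facets, hence in [I], a
    contradiction. *)
Lemma associated_facet P : associated_prime I P ->
  exists2 F, facet F & P = coord_prime (~: F).
Proof.
move=> [prP [f Pf]].
pose A := [set F | facet F & f \notin coord_prime (~: F)].
have subA F : F \in A -> {subset P <= coord_prime (~: F)}.
  rewrite inE => /andP[facF fF] g; rewrite Pf => /mem_SR_coord/(_ F facF).
  by case: (coord_prime_prime K (~: F)) => _ pr /pr; rewrite (negbTE fF) orbF.
suff [F FA sub] : exists2 F, F \in A & {subset coord_prime (~: F) <= P}.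
  exists F; first by move: FA; rewrite inE => /andP[].
  by apply/funext => g; apply/idP/idP => [/(subA F FA)|/sub].
apply: contrapT => none.
have [g gP] : {g : {set 'I_n} -> S & forall F, F \in A ->
    g F \in coord_prime (~: F) /\ g F \notin P}.
  apply: (choice (P := fun F x => F \in A -> x \in coord_prime (~: F) /\ x \notin P)) => F.
  have [FA|_] := boolP (F \in A); last by exists 0.
  apply: contrapT => noF; apply: none; exists F => // x xF.
  by apply/contraT => xP; case: noF; exists x.
have : \prod_(F in A) g F \notin P by apply: prime_prodPn => // F /gP[].
apply/negP; rewrite negbK Pf; apply/mem_SR_coord => F facF.
have [idF _] := coord_prime_prime K (~: F).
have [fF|fF] := boolP (f \in coord_prime (~: F)); first exact: idealMl.
have FA : F \in A by rewrite inE facF.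
rewrite mulrC (idealMl idF) // (bigD1 F) //= mulrC (idealMl idF) //.
by case: (gP F FA).
Qed.

Lemma unmixed_SRP : unmixed I <-> exists h, forall F, facet F -> #|~: F| = h.
Proof.
split=> -[h H]; exists h; last first.
  by move=> P /associated_facet[F /H <- ->]; apply: coord_prime_height.
move=> F facF; have [c1 max1] := H _ (facet_associated facF).
have [c2 max2] := coord_prime_height K (~: F).
by apply/eqP; rewrite eqn_leq max1 // max2.
Qed.

Lemma SR_complexE : SR_complex I = U.
Proof.
apply/setP => F; apply/imsetP/idP => [[g + ->]|FU].
  rewrite inE => /andP[_]; apply: contraR => gU.
  by apply/mem_I => m; rewrite msuppX inE => /eqP->.
have lt : (mdeg (mesym1 F) < n.+1)%N by rewrite mdeg_mesym1 ltnS -[leqRHS]card_ord max_card.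
exists (BMultinom lt); last by rewrite /= sigma_mesym1.
rewrite inE /= squarefree_mesym1; apply/negP => /mem_I/(_ (mesym1 F)).
by rewrite msuppX mem_head sigma_mesym1 FU => /(_ isT).
Qed.

End Complex.

End StanleyReisner.

(** * Translation of the algebraic conditions for an ideal of degree $d$ *)

Section IdealOfDegree.

Variables (K : fieldType) (n d : nat) (I : {pred {mpoly K[n]}}).
Hypothesis I_d : squarefree_ideal_of_degree d I.

Definition gen_sets : {set {set 'I_n}} :=
  [set sigma u | u : 'X_{1..n < n.+1} in mingens I].

Lemma generates_mingens : generates (mingens I) I.
Proof.
have [[A _ genA] _ _] := I_d; rewrite /mingens; case: pickP => [B /minsetp /asboolP //|none].
have [B minB _] := minset_exists (P := fun B => `[< generates B I >]) (asboolT genA).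
by rewrite none in minB.
Qed.

(** With [A] a square-free generating set, [u] is divisible by some [a] in [A], itself divisible by
    some [u'] in [mingens I]. As [u] and [u'] both have degree $d$, [a] equals [u]. *)
Lemma squarefree_mingens u : u \in mingens I -> squarefree u.
Proof.
have [[A sqA genA] _ deg] := I_d; move=> uG.
have memX (B : {set 'X_{1..n < n.+1}}) (v : 'X_{1..n}) : generates B I ->
    'X_[v] \in I <-> exists2 b, b \in B & (b <= v)%MM.
  move=> /generates_mem H; rewrite H msuppX; split=> [/(_ v (mem_head _ _))//|ex m].
  by rewrite inE => /eqP->.
have /(memX _ _ genA)[a aA au] : 'X_[u] \in I.
  by apply/(memX _ _ generates_mingens); exists u => //; apply: lepm_refl.
have /(memX _ _ generates_mingens)[u' u'G u'a] : 'X_[a] \in I.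
  by apply/(memX _ _ genA); exists a => //; apply: lepm_refl.
suff <- : val a = val u by apply: sqA.
apply: (mdeg_le_eq au); have := deg _ uG; have := deg _ u'G.
have := congr1 mdeg (submK au); have := congr1 mdeg (submK u'a).
by rewrite !mdegD; lia.
Qed.

Lemma gen_sets_card : {in gen_sets, forall E : {set 'I_n}, #|E| = d}.
Proof.
have [_ _ deg] := I_d.
by move=> _ /imsetP[u uG ->]; rewrite -mdeg_squarefree ?deg ?squarefree_mingens.
Qed.

Lemma card_gen_sets : #|gen_sets| = #|mingens I|.
Proof.
rewrite card_in_imset // => u v uG vG eq_uv; apply: val_inj.
by apply: squarefree_sigma_inj eq_uv; apply: squarefree_mingens.
Qed.

Lemma gen_sets_neq0 : (0 < #|gen_sets|)%N.
Proof.
rewrite card_gen_sets card_gt0; have [_ [f /generates_mingens[c ->]] nz _] := I_d.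
by apply: contraNneq nz => ->; rewrite big_set0.
Qed.

Lemma sigma_non_gens :
  [set sigma u | u : 'X_{1..n < n.+1} in sm n d :\: mingens I] = non_gens d gen_sets.
Proof.
apply/setP => F; apply/imsetP/non_gensP => [[u]|[cF FG]].
  rewrite !inE => /and3P[uG sqm /eqP du] ->; rewrite -mdeg_squarefree //; split=> //.
  apply: contra uG => /imsetP[v vG eq_uv].
  suff -> : u = v by [].
  by apply/val_inj/squarefree_sigma_inj => //; apply: squarefree_mingens.
have lt : (mdeg (mesym1 F) < n.+1)%N by rewrite mdeg_mesym1 ltnS -[leqRHS]card_ord max_card.
exists (BMultinom lt); last by rewrite /= sigma_mesym1.
rewrite !inE /= squarefree_mesym1 mdeg_mesym1 cF eqxx !andbT.
by apply: contra FG => uG; apply/imsetP; exists (BMultinom lt); rewrite /= ?sigma_mesym1.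
Qed.

Lemma mem_free_sets f :
  f \in I <-> {in msupp f, forall m, sigma m \notin free_sets gen_sets}.
Proof.
rewrite (generates_mem f generates_mingens); split=> H m /H.
  case=> u uG um; apply/free_setsPn; exists (sigma u); first exact: imset_f.
  by rewrite -squarefree_le ?squarefree_mingens.
case/free_setsPn => _ /imsetP[u uG ->] sub; exists u => //.
by rewrite squarefree_le ?squarefree_mingens.
Qed.

Lemma f_idealP :
  f_ideal I <->
  [/\ #|mingens I|.*2 = 'C(n, d),
      forall F : {set 'I_n}, (#|F| < d)%N -> F \in facet_complex I
    & forall F : {set 'I_n}, (d < #|F|)%N -> F \notin free_sets gen_sets].
Proof.
rewrite /f_ideal (SR_complexE mem_free_sets) -card_gen_sets.
exact: same_f_vectorP gen_sets_card.
Qed.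

Hypothesis half : #|mingens I|.*2 = 'C(n, d).

(** The generators are half of all $d$-sets and there is at least one, so as many remain outside. *)
Lemma ex_non_gen : exists F, F \in non_gens d gen_sets.
Proof.
apply/set0Pn; rewrite -card_gt0 cardsD.
have := card_draws 'I_n d; rewrite card_ord => ->.
have := subset_leq_card (subsetIr [set F : {set 'I_n} | #|F| == d] gen_sets).
have := gen_sets_neq0; rewrite card_gen_sets -half.
by set g := #|mingens I|; set b := #|_|; lia.
Qed.

(** By [big], the $d$-sets outside $G$ are facets of $U$. One exists, so a common height must be
    $n-d$ and all facets have $d$ elements; a small set, being free, lies in one of them. The
    converse is the purity from [free_sets_span]. *)
Lemma unmixedP :
  (forall F : {set 'I_n}, (d < #|F|)%N -> F \notin free_sets gen_sets) ->
  unmixed I <->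
  forall F : {set 'I_n}, (#|F| < d)%N -> F \in complex_span (non_gens d gen_sets).
Proof.
move=> big; rewrite (unmixed_SRP (@free_sets_sub _ _) mem_free_sets).
have cE := gen_sets_card.
have cC (F : {set 'I_n}) : (#|F| + #|~: F| = n)%N by rewrite cardsC card_ord.
have facet_d F : F \in non_gens d gen_sets -> facet (free_sets gen_sets) F.
  case/non_gensP => cF FG; apply/maxsetP; rewrite (mem_free_card cE) //; split=> // E EU sFE.
  apply/eqP; rewrite eq_sym eqEcard sFE /= cF leqNgt.
  by apply: contraTN EU => /big.
split=> [[h H] F ltF | small].
  have [E facE sFE] := maxset_exists (P := fun E => E \in _) (free_sets_small cE ltF).
  apply/complex_spanP; exists E => //; have /maxsetp EU := facE.
  have [F0 F0N] := ex_non_gen; have [cF0 _] := non_gensP _ _ _ F0N.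
  have cEd : #|E| = d.
    by have := H _ facE; have := H _ (facet_d _ F0N); have := cC E; have := cC F0; lia.
  by apply/non_gensP; rewrite -(mem_free_card cE).
exists (n - d)%N => F /maxsetP[FU maxF].
have := FU; rewrite (free_sets_span cE small big) => /complex_spanP[E EN sFE].
have [cEd _] := non_gensP _ _ _ EN.
have eqE : E = F by apply: maxF => //; have /maxsetp := facet_d _ EN.
by have := cC F; rewrite -eqE; lia.
Qed.

End IdealOfDegree.

Lemma half_ratP (g c : nat) : g%:R = 1 / 2%:R * c%:R :> rat <-> g.*2 = c.
Proof.
have two : (2%:R : rat) != 0 by [].
split=> [E|<-]; last by rewrite -muln2 natrM mul1r mulrCA mulVf // mulr1.
apply/eqP; rewrite -(Num.Theory.eqr_nat rat) -muln2 natrM E mul1r mulrAC mulVf //.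
by rewrite mul1r.
Qed.

Theorem proposition2p1 (K : fieldType) (n d : nat) (I : {pred {mpoly K[n]}}) :
  squarefree_ideal_of_degree d I ->
  (f_ideal I /\ unmixed I) <->
  [/\ #|mingens I|%:R = 1 / 2%:R * 'C(n, d)%:R :> rat,
      has_dim (alexander_dual (facet_complex I)) (n%:Z - d%:Z - 1)
    & flag_complex d
        (complex_span [set sigma u | u : 'X_{1..n < n.+1} in sm n d :\: mingens I])].
Proof.
move=> I_d; have cE := gen_sets_card I_d.
rewrite (sigma_non_gens I_d); split.
  case=> /(f_idealP I_d)[half small big] /(unmixedP I_d half big) unm.
  split; [exact/half_ratP | apply/has_dim_dualP | exact/(flag_complexP cE)].
  (* The dimension of the dual must be attained, which takes a $d$-set outside $G$. *)
  split=> //; have [F /non_gensP[cF FG]] := ex_non_gen I_d half.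
  by exists F => //; rewrite (mem_span_card cE).
case=> /half_ratP half /has_dim_dualP[_ small] /(flag_complexP cE)[unm big].
by split; [apply/(f_idealP I_d) | apply/(unmixedP I_d half big)].
Qed.
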